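(* Let $\gamma\in\mathbb{R}\setminus\{0\}$. (i) Let $s,\ell>0$ and consider, for each $N$, a chain of $N$ resonators with all spacings equal to $s$ and all lengths equal to $\ell$. For $1\le k\le N$, let $\lambda_k=\lambda_k(N)$ be given by $\lambda_1=0$ and $$\lambda_k=\frac{\gamma}{s}\coth\!\left(\frac{\gamma\ell}{2}\right)+\frac{2|\gamma|}{s}\frac{e^{\gamma\ell/2}}{|e^{\gamma\ell}-1|}\cos\!\left(\frac{\pi}{N}(k-1)\right),\quad 2\le k\le N,$$ which are the eigenvalues of the problem $\mathcal{C}^\gamma\boldsymbol{a}=\lambda\,\ell\,\boldsymbol{a}$ for the gauge capacitance matrix $\mathcal{C}^\gamma$ of the chain. Then for each $k$ there exists $(\alpha,\beta(\alpha))\in\mathcal{Y}^*$ (the generalised Brillouin zone of the corresponding infinite periodic chain) such that $|\lambda_k-\lambda^{\alpha+\mathbf{i}\beta(\alpha)}|\to 0$ as $N\to+\infty$. (ii) Let $s_1,s_2>0$ and consider a chain of $M$ dimers, i.e. $2M$ resonators of length $1$ with spacings alternating between $s_1$ and $s_2$. Then the same result as in (i) holds as the number of dimers goes to infinity: for each eigenvalue $\lambda_k=\lambda_k(M)$ of the gauge capacitance matrix of the chain, there exist $(\alpha,\beta(\alpha))\in\mathcal{Y}^*$ (the generalised Brillouin zone of the corresponding infinite periodic chain of dimers) and $i\in\{1,2\}$ such that $|\lambda_k-\lambda_i^{\alpha+\mathbf{i}\beta(\alpha)}|\to 0$ as $M\to+\infty$.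
   Context: Gauge capacitance matrix of a finite chain: for $N$ resonators with lengths $\ell_1,\dots,\ell_N$ and spacings $s_1,\dots,s_{N-1}$ ($s_i$ between resonators $i$ and $i+1$), $\mathcal{C}^\gamma\in\mathbb{R}^{N\times N}$ is tridiagonal with $\mathcal{C}^\gamma_{i,i+1}=-\frac{\gamma}{s_i}\frac{\ell_i}{1-e^{-\gamma\ell_i}}$, $\mathcal{C}^\gamma_{i,i-1}=\frac{\gamma}{s_{i-1}}\frac{\ell_i}{1-e^{\gamma\ell_i}}$, and $\mathcal{C}^\gamma_{i,i}=-\mathcal{C}^\gamma_{i,i+1}-\mathcal{C}^\gamma_{i,i-1}$ (terms with index outside $\{1,\dots,N\}$ being omitted). In (ii), all lengths equal $1$, and the spacing between resonators $2m-1$ and $2m$ is $s_1$ while that between $2m$ and $2m+1$ is $s_2$. Bands of the infinite periodic structure, for complex quasiperiodicity $\alpha\in\mathbb{C}$: - Single repeated resonator (case (i)), period $L=\ell+s$: $$\lambda^\alpha=\frac{\gamma}{s\,(e^{\gamma\ell}-1)}\left(e^{\gamma\ell}+1-e^{\gamma\ell}e^{-\mathbf{i}\alpha L}-e^{\mathbf{i}\alpha L}\right),$$ and one sets $\lambda_1^\alpha=\lambda_2^\alpha=\lambda^\alpha$. - Repeated dimer (case (ii)), period $L=2+s_1+s_2$: $\lambda_1^\alpha,\lambda_2^\alpha$ are the two eigenvalues of the quasiperiodic gauge capacitance matrix, namely $$\lambda_{1,2}^\alpha=\frac{\gamma\left((e^\gamma+1)(s_1+s_2)\mp\sqrt2\,e^{\gamma/2}\sqrt{4s_1s_2\cosh(\gamma-\mathbf{i}\alpha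 L)+\cosh(\gamma)(s_1-s_2)^2+(s_1+s_2)^2}\right)}{2(e^\gamma-1)s_1s_2},$$ with the sign $-$ for $\lambda_1^\alpha$ and $+$ for $\lambda_2^\alpha$. With $Y^*=(-\frac{\pi}{L},\frac{\pi}{L}]$, the generalised Brillouin zone is $$\mathcal{Y}^*=\{(\alpha,\beta(\alpha))\in Y^*\times\mathbb{R}:\ \lambda_i^{\alpha+\mathbf{i}\beta(\alpha)}\in\mathbb{R}^+\text{ for } i=1\text{ or }2\},$$ where $\mathbb{R}^+=[0,\infty)$; $\mathbf{i}$ is the imaginary unit. *)

(* Defs.v *)
From mathcomp Require Import all_boot all_order all_algebra.
From mathcomp Require Import complex.
From mathcomp Require Import all_classical all_reals all_analysis.

Set Implicit Arguments.
Unset Strict Implicit.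
Unset Printing Implicit Defensive.

Import Order.TTheory GRing.Theory Num.Theory.
Import numFieldNormedType.Exports.

Local Open Scope classical_set_scope.
Local Open Scope ring_scope.
Local Open Scope complex_scope.

Definition imag (R : realType) : R[i] := 0 +i* 1.

Definition cexp (R : realType) (z : R[i]) : R[i] :=
  (expR (complex.Re z))%:C * (cos (complex.Im z) +i* sin (complex.Im z)).

Definition ccosh (R : realType) (z : R[i]) : R[i] :=
  (cexp z + cexp (- z)) / 2.

Definition coth (R : realType) (x : R) : R :=
  (expR x + expR (- x)) / (expR x - expR (- x)).

(* Indices are shifted by one: [ell i] is the length of resonator i+1 and
   [s i] is the spacing between resonators i+1 and i+2. *)
Definition gauge_upper (R : realType) (gamma : R) (ell s : nat -> R) (i : nat) : R :=
  - (gamma / s i * (ell i / (1 - expR (- gamma * ell i)))).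

Definition gauge_lower (R : realType) (gamma : R) (ell s : nat -> R) (i : nat) : R :=
  gamma / s i.-1 * (ell i / (1 - expR (gamma * ell i))).

Definition gauge_capacitance (R : realType) (gamma : R) (ell s : nat -> R)
    (N : nat) : 'M[R]_N :=
  \matrix_(i < N, j < N)
    if j == i.+1 :> nat then gauge_upper gamma ell s i
    else if i == j.+1 :> nat then gauge_lower gamma ell s i
    else if i == j then
      - (if (i.+1 < N)%N then gauge_upper gamma ell s i else 0)
      - (if (0 < i)%N then gauge_lower gamma ell s i else 0)
    else 0.

(* Eigenvectors and eigenvalues are a priori complex. *)
Definition scaled_eigenvalue (R : realType) (N : nat) (A : 'M[R]_N) (ell : R)
    (z : R[i]) : Prop :=
  exists2 a : 'cV[R[i]]_N, a != 0 &
    map_mx (real_complex R) A *m a = (z * ell%:C) *: a.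

(* The eigenvalues of A a = lambda ell a are lam 1, ..., lam N. *)
Definition enumerates_eigenvalues (R : realType) (N : nat) (A : 'M[R]_N)
    (ell : R) (lam : nat -> R) : Prop :=
  forall z : R[i], scaled_eigenvalue A ell z <->
    exists2 k : nat, (1 <= k <= N)%N & z = (lam k)%:C.

Definition single_eigenvalue (R : realType) (gamma s ell : R) (N k : nat) : R :=
  if k == 1%N then 0
  else gamma / s * coth (gamma * ell / 2)
       + 2 * `|gamma| / s * (expR (gamma * ell / 2) / `|expR (gamma * ell) - 1|)
         * cos (pi / N%:R * (k.-1)%:R).

Definition dimer_spacing (R : realType) (s1 s2 : R) (i : nat) : R :=
  if odd i then s2 else s1.

Definition dimer_capacitance (R : realType) (gamma s1 s2 : R) (M : nat) :
    'M[R]_(2 * M) :=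
  gauge_capacitance gamma (fun=> 1) (dimer_spacing s1 s2) (2 * M).

(* The two bands are indexed by 'I_2: index 0 is band 1, index 1 is band 2. *)
Definition single_band (R : realType) (gamma s ell : R) (_ : 'I_2)
    (z : R[i]) : R[i] :=
  let L := ell + s in
  (gamma / (s * (expR (gamma * ell) - 1)))%:C *
  ((expR (gamma * ell))%:C + 1
   - (expR (gamma * ell))%:C * cexp (- (imag R * z * L%:C)) - cexp (imag R * z * L%:C)).

(* [sqrtc] is the principal square root; the other branch exchanges the bands. *)
Definition dimer_band (R : realType) (gamma s1 s2 : R) (j : 'I_2)
    (z : R[i]) : R[i] :=
  let L := 2 + s1 + s2 in
  let root := sqrtc ((4 * s1 * s2)%:C * ccosh (gamma%:C - imag R * z * L%:C)
                     + ccosh gamma%:C * ((s1 - s2) ^+ 2)%:C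
                     + ((s1 + s2) ^+ 2)%:C) in
  let sign : R[i] := if j == 0 then -1 else 1 in
  gamma%:C * (((expR gamma + 1) * (s1 + s2))%:C
              + sign * ((Num.sqrt 2 * expR (gamma / 2))%:C * root))
  / (2 * (expR gamma - 1) * s1 * s2)%:C.

(* In R[i], [0 <= z] means that z is real and nonnegative. *)
Definition generalised_brillouin_zone (R : realType) (L : R)
    (band : 'I_2 -> R[i] -> R[i]) : set (R * R) :=
  [set p | - (pi / L) < p.1 <= pi / L /\
           exists i : 'I_2, 0 <= band i (p.1 +i* p.2)].

Definition approaches_fixed_point (R : realType) (L : R)
    (band : 'I_2 -> R[i] -> R[i]) (mu : nat -> R) : Prop :=
  exists (p : R * R) (i : 'I_2),
    generalised_brillouin_zone L band p /\
    Normc.normc ((mu n)%:C - band i (p.1 +i* p.2)) @[n --> \oo] --> (0 : R).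

Definition approaches_moving_point (R : realType) (L : R)
    (band : 'I_2 -> R[i] -> R[i]) (mu : nat -> R) : Prop :=
  exists (p : nat -> R * R) (i : nat -> 'I_2),
    (forall n, generalised_brillouin_zone L band (p n)) /\
    Normc.normc ((mu n)%:C - band (i n) ((p n).1 +i* (p n).2)) @[n --> \oo]
      --> (0 : R).

(* Main.v *)
(* Every real [l >= 0] is a value of the bands at some point of the generalised
   Brillouin zone, since both dispersion relations have the form
   [cosh (g - i alpha L) = c] with [c] real, and this is solvable in complex
   [alpha] for every real [c]. Hence any sequence of nonnegative eigenvalues is
   matched exactly by moving points, and the approximation by a fixed point only
   requires the eigenvalue sequence to converge.

   For this, the differences [f_i = (a_i - a_(i+1)) / s_i] of an eigenvector turn
   the chain into a Dirichlet problem
   [p f_(i+1) = (p + q - z s_i) f_i - q f_(i-1)], so that the eigenvalues of a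
   chain of [N] resonators are 0 and the roots of an orthogonal-type polynomial
   of degree [N - 1]. For equal spacings this is a rescaled Chebyshev polynomial
   of the second kind. In general the roots of consecutive polynomials interlace,
   so the k-th smallest eigenvalue decreases and the k-th largest one increases
   with the length of the chain. *)

Require Import Defs.
From mathcomp Require Import all_boot all_order all_algebra.
From mathcomp Require Import complex.
From mathcomp Require Import ring lra zify.
From mathcomp Require Import all_classical all_reals all_analysis.

Set Implicit Arguments.
Unset Strict Implicit.
Unset Printing Implicit Defensive.

Import Order.TTheory GRing.Theory Num.Theory.
Import numFieldNormedType.Exports.
Local Open Scope ring_scope.

(** * The three-term recurrence dual to the chain *)

Section DualRecurrence.

Variables (F : fieldType) (p q : F) (s : nat -> F).

(** The continuant of a tridiagonal pencil: [dual_poly n] is the determinant of the [n] by [n]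
    matrix with diagonal entries [p + q - s i * X] and products [p * q] of opposite off-diagonal
    entries. *)
Fixpoint dual_poly (n : nat) : {poly F} :=
  if n is m.+1 then
    ((p + q)%:P - s m *: 'X) * dual_poly m
    - (if m is l.+1 then (p * q) *: dual_poly l else 0)
  else 1.

Lemma dual_polySS n :
  dual_poly n.+2 =
  ((p + q)%:P - s n.+1 *: 'X) * dual_poly n.+1 - (p * q) *: dual_poly n.
Proof. by []. Qed.

Lemma horner_dual_poly0 z : (dual_poly 0).[z] = 1.
Proof. exact: hornerC. Qed.

Lemma horner_dual_poly1 z : (dual_poly 1).[z] = p + q - s 0%N * z.
Proof. by rewrite /= subr0 mulr1 !hornerE. Qed.

Lemma horner_dual_poly z n :
  (dual_poly n.+2).[z] =
  (p + q - s n.+1 * z) * (dual_poly n.+1).[z] - p * q * (dual_poly n).[z].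
Proof. by rewrite dual_polySS !hornerE. Qed.

Lemma size_dual_poly n : (forall i, s i != 0) -> size (dual_poly n) = n.+1.
Proof.
move=> s0; have size_fac i : size ((p + q)%:P - s i *: 'X) = 2%N.
  rewrite addrC size_polyDl size_polyN size_scale // size_polyX //.
  by rewrite ltnS size_polyC; case: (_ != 0).
elim/ltn_ind: n => -[|[|n]] IH.
- exact: size_poly1.
- by rewrite [dual_poly 1]/= subr0 mulr1 size_fac.
- rewrite dual_polySS.
  have sz : size (((p + q)%:P - s n.+1 *: 'X) * dual_poly n.+1) = n.+3.
    have sz1 := IH n.+1 (ltnSn _).
    by rewrite size_mul ?size_fac ?sz1 // -size_poly_eq0 ?size_fac ?sz1.
  rewrite size_polyDl sz // size_polyN.
  by rewrite (leq_ltn_trans (size_scale_leq _ _)) ?IH.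
Qed.

(** The chain has the [N.+1] sites [0, ..., N], hence [N] gaps. Since the capacitance matrix has
    zero row sums, each row acts on differences only; the two conditionals drop the missing
    neighbours at the ends. *)
Definition chain_op (N : nat) (a : nat -> F) (i : nat) : F :=
  (if (i < N)%N then p / s i * (a i - a i.+1) else 0)
  + (if (0 < i)%N then q / s i.-1 * (a i - a i.-1) else 0).

(* The weighted differences [f i = (a i - a i.+1) / s i] of an eigenvector obey
   a three-term recurrence with Dirichlet conditions at both ends. *)
Lemma chain_eigen (N : nat) (z : F) :
  (forall i, s i != 0) -> p != 0 ->
  (exists2 a : nat -> F, exists2 i, (i <= N)%N & a i != 0 &
     forall i, (i <= N)%N -> chain_op N a i = z * a i)
  <-> z * (dual_poly N).[z] = 0.
Proof.
move=> s0 p0; split.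
- move=> [a [i0 i0N ai0] Ea].
  (* [g] is the weighted difference [f] shifted by one, so that [g 0 = 0] and [g N.+1 = 0] are the
     two Dirichlet conditions. *)
  pose g i := if i is j.+1 then
                if (j < N)%N then (a j - a i) / s j else 0 else 0.
  have Eg i : (i <= N)%N -> p * g i.+1 - q * g i = z * a i.
    move=> iN; rewrite -Ea // /chain_op /g; case: i iN => [|i] iN /=.
      by case: ifP => _; field.
    by rewrite iN; case: ifP => _; field; rewrite ?s0.
  have rec_g i : (i < N)%N ->
      p * g i.+2 = (p + q - s i * z) * g i.+1 - q * g i.
    move=> iN; have := Eg _ (ltnW iN); have := Eg _ iN => E1 E2.
    have E3 : s i * g i.+1 = a i - a i.+1 by rewrite /g iN; field.
    apply/eqP; rewrite -subr_eq0; apply/eqP.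
    transitivity ((p * g i.+2 - q * g i.+1) - (p * g i.+1 - q * g i)
                  + z * (s i * g i.+1)); first by ring.
    by rewrite E1 E2 E3; ring.
  have claim i : (i <= N)%N ->
      p ^+ i.+1 * g i.+1 = z * a 0%N * (dual_poly i).[z].
    elim/ltn_ind: i => -[|[|i]] IH iN.
    + by rewrite horner_dual_poly0 mulr1 -Eg // /= mulr0 subr0.
    + have := IH 0%N isT isT; rewrite horner_dual_poly0 horner_dual_poly1 => E.
      rewrite exprSr -mulrA rec_g //= mulr0 subr0 mulrCA E; ring.
    + have E1 := IH i.+1 (ltnSn _) (ltnW iN).
      have E2 := IH i (ltnW (ltnSn _)) (ltnW (ltnW iN)).
      rewrite horner_dual_poly exprSr -mulrA rec_g //.
      transitivity ((p + q - s i.+1 * z) * (p ^+ i.+2 * g i.+2)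
                    - p * q * (p ^+ i.+1 * g i.+1)); first by rewrite !exprS; ring.
      by rewrite E1 E2; ring.
  (* If [a 0] vanished, the claim would kill every difference, and [a] would be zero on the whole
     chain. *)
  have a0 : a 0%N != 0.
    apply: contra ai0 => /eqP a00; apply/eqP.
    elim: i0 i0N => [|i IH] iN //.
    have /eqP := claim i (ltnW iN).
    rewrite a00 mulr0 mul0r mulf_eq0 expf_eq0 (negPf p0) andbF /= iN.
    rewrite mulf_eq0 invr_eq0 (negPf (s0 _)) orbF subr_eq0 IH ?(ltnW iN) //.
    by move/eqP.
  have := claim N (leqnn _); rewrite /g ltnn mulr0 => E.
  by apply: (mulfI a0); rewrite mulr0 mulrCA mulrA -E.
- move=> z0.
  (* The differences are read off from the claim of the direct part, normalised by [a 0 = 1]; for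
     [z = 0] this gives the constant vector. *)
  pose f i := z * (dual_poly i).[z] / p ^+ i.+1.
  pose a i := 1 - \sum_(j < i) s j * f j.
  have aS i : a i - a i.+1 = s i * f i by rewrite /a big_ord_recr /=; ring.
  have pX n : p ^+ n != 0 by rewrite expf_neq0.
  have key i : p * f i - (if i is j.+1 then q * f j else 0) = z * a i.
    elim: i => [|i IH].
      by rewrite /f /a horner_dual_poly0 big_ord0 expr1; field.
    have -> : z * a i.+1 = z * a i - z * (s i * f i) by rewrite -aS; ring.
    rewrite -IH; case: i {IH} => [|i]; rewrite /f.
      by rewrite horner_dual_poly1 horner_dual_poly0 !exprS expr0; field.
    by rewrite horner_dual_poly !exprS; field; rewrite p0 pX.
  exists a.
    by exists 0%N => //; rewrite /a big_ord0 subr0 oner_eq0.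
  (* At [i = N] the absent coupling to the right is accounted for by [f N = 0], which is the
     assumption on [z]. *)
  move=> i; rewrite leq_eqVlt => /orP[/eqP->|iN]; rewrite -key /chain_op.
  + rewrite ltnn {1}/f z0 mul0r mulr0 add0r sub0r; case: N {z0} => [|n] //=.
      by rewrite oppr0.
    by rewrite -opprB aS; field.
  + rewrite iN aS; case: i {iN} => [|i] /=; first by field.
    by rewrite -[a i.+1 - a i]opprB aS; field; rewrite !s0.
Qed.

End DualRecurrence.

Lemma map_dual_poly (F K : fieldType) (f : {rmorphism F -> K}) (p q : F)
    (s : nat -> F) (n : nat) :
  map_poly f (dual_poly p q s n) = dual_poly (f p) (f q) (f \o s) n.
Proof.
elim/ltn_ind: n => -[|[|n]] IH.
- by rewrite /= rmorph1.
- by rewrite /= !subr0 !mulr1 rmorphB /= map_polyC linearZ /= map_polyX rmorphD.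
- have := IH n.+1 (ltnSn _); have := IH n (ltnW (ltnSn _)).
  rewrite !dual_polySS; move: (dual_poly p q s n) (dual_poly p q s n.+1) => d d' <- <-.
  rewrite rmorphB rmorphM rmorphB /= !map_polyZ map_polyC map_polyX rmorphM.
  by congr ((_%:P - _) * _ - _); exact: rmorphD.
Qed.

Lemma dual_poly_factor (F : fieldType) (p q : F) (s u : nat -> F) (n : nat) :
  (forall i, s i != 0) -> uniq (mkseq u n) ->
  (forall i, (i < n)%N -> root (dual_poly p q s n) (u i)) ->
  dual_poly p q s n =
  lead_coef (dual_poly p q s n) *: \prod_(i < n) ('X - (u i)%:P).
Proof.
move=> s0 uu ru; rewrite -(big_mkord xpredT (fun i => 'X - (u i)%:P)).
rewrite /index_iota subn0 -(big_map u xpredT (fun z => 'X - z%:P)).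
apply: all_roots_prod_XsubC.
- by rewrite size_dual_poly // size_mkseq.
- by apply/allP => x /mapP[k]; rewrite mem_iota => /= kN ->; apply: ru.
- by rewrite uniq_rootsE.
Qed.

(** Exactly the first [i] factors are negative. This reads off the sign of a split polynomial
    between two consecutive roots. *)
Lemma sgn_prod (R : realDomainType) (G : nat -> R) (n i : nat) :
  (i <= n)%N ->
  (forall j, (j < i)%N -> G j < 0) ->
  (forall j, (i <= j < n)%N -> 0 < G j) ->
  0 < (-1) ^+ i * \prod_(j < n) G j.
Proof.
elim: n i => [|n IH] i.
  by rewrite leqn0 => /eqP-> _ _; rewrite big_ord0 expr0 mulr1.
rewrite leq_eqVlt => /orP[/eqP->|iN] Gneg Gpos; rewrite big_ord_recr /=.
- have H : 0 < (-1) ^+ n * \prod_(j < n) G j.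
    apply: IH => // j.
    - by move=> jn; apply: Gneg; apply: ltnW.
    - by rewrite ltnNge; case: leq.
  rewrite exprS mulN1r mulNr mulrA -mulrN; apply: mulr_gt0 => //.
  by rewrite oppr_gt0 Gneg.
- rewrite mulrA; apply: mulr_gt0; last by apply: Gpos; rewrite -ltnS iN ltnSn.
  apply: IH => // j /andP[ij jn]; apply: Gpos.
  by rewrite ij ltnW.
Qed.

(** * Interlacing of the roots of consecutive polynomials *)

Section Interlacing.

Variables (R : realType) (p q m : R) (s : nat -> R).
Hypotheses (p_gt0 : 0 < p) (q_gt0 : 0 < q) (m_gt0 : 0 < m).
Hypothesis s_ge : forall i, m <= s i.

Local Notation J := (dual_poly p q s).

(** Chosen so that at this point every factor [p + q - s i * X] is at most [- (p + q)], which makes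
    the values of consecutive polynomials alternate in sign. *)
Definition root_bound : R := 2 * (p + q) / m.

Let s_neq0 i : s i != 0.
Proof. by rewrite gt_eqF // (lt_le_trans m_gt0). Qed.

Lemma root_bound_gt0 : 0 < root_bound.
Proof. by rewrite divr_gt0 // mulr_gt0 ?addr_gt0. Qed.

Lemma dual_poly_at0 n : 0 < (J n).[0].
Proof.
have p0 := p_gt0; have q0 := q_gt0.
(* The strengthening is inductive because at 0 the recurrence factors as [J n.+2 - p * J n.+1 = q *
   (J n.+1 - p * J n)]. *)
suff: 0 < (J n).[0] /\ p * (J n).[0] < (J n.+1).[0] by case.
elim: n => [|n [IH1 IH2]].
  rewrite horner_dual_poly0 horner_dual_poly1 mulr0; split; lra.
split; first by apply: lt_trans IH2; rewrite mulr_gt0.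
rewrite horner_dual_poly mulr0 subr0.
have : 0 < q * ((J n.+1).[0] - p * (J n).[0]) by rewrite mulr_gt0 // subr_gt0.
lra.
Qed.

Lemma dual_poly_at_bound n : 0 < (-1) ^+ n * (J n).[root_bound].
Proof.
have p0 := p_gt0; have q0 := q_gt0.
have sB i : 2 * (p + q) <= s i * root_bound.
  by rewrite /root_bound mulrA ler_pdivlMr // mulrC ler_wpM2r // ltW // mulr_gt0 ?addr_gt0.
(* By [sB], the signed values grow at least as under the recurrence at 0, so the same strengthening
   works. *)
suff: 0 < (-1) ^+ n * (J n).[root_bound] /\
      p * ((-1) ^+ n * (J n).[root_bound])
        < (-1) ^+ n.+1 * (J n.+1).[root_bound] by case.
elim: n => [|n [IH1 IH2]].
  rewrite horner_dual_poly0 horner_dual_poly1 expr0 expr1; have := sB 0%N.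
  by split; lra.
split; first by apply: lt_trans IH2; rewrite mulr_gt0.
rewrite horner_dual_poly; have := sB n.+1; move: IH1 IH2.
rewrite !exprS; set e := _ ^+ n; set B := root_bound.
set x := (J n).[B]; set y := (J n.+1).[B] => IH1 IH2 H.
have -> : -1 * (-1 * e) * ((p + q - s n.+1 * B) * y - p * q * x) =
  (s n.+1 * B - (p + q)) * (-1 * e * y) - p * q * (e * x) by ring.
set X := e * x in IH1 IH2 *; set Y := -1 * e * y in IH2 *.
have Y0 : 0 < Y by apply: lt_trans IH2; rewrite mulr_gt0.
have := ler_wpM2r (ltW Y0) H.
have : 0 < q * (Y - p * X) by rewrite mulr_gt0 // subr_gt0.
lra.
Qed.

(* [v 0 = 0] and [v n.+1 = root_bound] frame the [n] roots of [J n]. *)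
Record nodes (n : nat) (v : nat -> R) : Prop := Nodes {
  nodes_first : v 0%N = 0;
  nodes_last : v n.+1 = root_bound;
  nodes_lt : forall i, (i <= n)%N -> v i < v i.+1;
  nodes_root : forall i, (i < n)%N -> root (J n) (v i.+1);
  nodes_alt : forall i, (i <= n.+1)%N -> 0 < (-1) ^+ i * (J n.+1).[v i] }.

Lemma nodes_mono n v i j : nodes n v -> (i < j)%N -> (j <= n.+1)%N -> v i < v j.
Proof.
move=> [_ _ vlt _ _]; elim: j => // j IH; rewrite ltnS leq_eqVlt.
case/orP => [/eqP->|ij] jn; first exact: vlt.
by apply: lt_trans (vlt _ _) => //; apply: IH => //; apply: ltnW.
Qed.

Lemma nodes_inj n v i j : nodes n v -> (i <= n.+1)%N -> (j <= n.+1)%N ->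
  v i = v j -> i = j.
Proof.
move=> nv iN jN E; case: (ltngtP i j) => // lt_ij.
- by have := nodes_mono nv lt_ij jN; rewrite E ltxx.
- by have := nodes_mono nv lt_ij iN; rewrite E ltxx.
Qed.

Lemma nodes_uniq n v : nodes n v -> uniq (mkseq (v \o succn) n).
Proof.
move=> nv; apply/mkseq_uniqP => i j /[!inE] iN jN /= /(nodes_inj nv) E.
by apply: succn_inj; apply: E; apply: leqW.
Qed.

(** Multiplying by [J n] at 0, which is positive, turns the unknown leading coefficient into a
    square. Each remaining factor [(x - v j.+1) * (0 - v j.+1)] is negative for a root below [x] and
    positive for a root above it. *)
Lemma nodes_sgn n v x i : nodes n v -> (i <= n)%N -> v i < x < v i.+1 ->
  0 < (-1) ^+ i * (J n).[x].
Proof.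
move=> nv iN /andP[ix xi].
have [v0 _ _ rv _] := nv.
have fac := dual_poly_factor s_neq0 (nodes_uniq nv) rv.
have J0 := dual_poly_at0 n.
rewrite -(pmulr_lgt0 _ J0); move: J0.
set c := lead_coef _ in fac; rewrite fac => J0.
have c0 : c != 0 by apply: contraTN J0 => /eqP->; rewrite scale0r horner0 ltxx.
rewrite !hornerZ !horner_prod.
under eq_bigr do rewrite hornerXsubC /=.
under [X in _ * (_ * X)]eq_bigr do rewrite hornerXsubC /=.
rewrite [X in 0 < X](_ : _ = c ^+ 2 *
   ((-1) ^+ i * \prod_(j < n) ((x - v j.+1) * (0 - v j.+1)))); last first.
  by rewrite big_split /=; ring.
rewrite pmulr_rgt0 ?exprn_even_gt0 //.
apply: (@sgn_prod _ (fun j => (x - v j.+1) * (0 - v j.+1))) => // j.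
- move=> ji; rewrite sub0r mulrN oppr_lt0 mulr_gt0 //.
  + rewrite subr_gt0; apply: le_lt_trans ix.
    move: ji; rewrite leq_eqVlt => /orP[/eqP->//|ji].
    by apply/ltW/(nodes_mono nv) => //; apply: leqW.
  + by rewrite -v0; apply: (nodes_mono nv) => //; apply: leqW; apply: leq_trans iN.
- case/andP=> ij jn; rewrite sub0r nmulr_rgt0 ?oppr_lt0 ?subr_lt0.
    by rewrite -v0; apply: (nodes_mono nv) => //; apply: leqW.
  apply: (lt_le_trans xi); move: ij; rewrite leq_eqVlt => /orP[/eqP->//|ij].
  by apply/ltW/(nodes_mono nv) => //; apply: leqW.
Qed.

Lemma nodes0 : nodes 0 (fun i => if i is 0 then 0 else root_bound).
Proof.
split=> //.
- by move=> [|//] _; apply: root_bound_gt0.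
- move=> [|[|//]] _; last exact: dual_poly_at_bound.
  by rewrite expr0 mul1r dual_poly_at0.
Qed.

(** [J n.+1] changes sign across each of the [n.+1] gaps of the frame, so it has a root inside each
    gap; these roots together with 0 and [root_bound] form the next frame. *)
Lemma nodes_step n v : nodes n v ->
  exists2 w, nodes n.+1 w & forall i, (i <= n)%N -> v i < w i.+1 < v i.+1.
Proof.
move=> nv; have [v0 vn vlt vr valt] := nv.
(* The range condition is kept as a premise so that the statement holds for every [i] and choice
   yields a function. *)
have ivt i : exists x, (i <= n)%N -> (v i < x < v i.+1) && root (J n.+1) x.
  have [iN|iN] := leqP i n; last by exists 0.
  have a0 := valt i (leqW iN); have a1 := valt i.+1 iN.
  have [x xi rx] : exists2 x, v i <= x <= v i.+1 & root ((-1) ^+ i.+1 *: J n.+1) x.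
    apply: poly_ivt; first exact/ltW/vlt.
    rewrite !hornerZ (ltW a1) andbT exprS mulN1r mulNr oppr_le0; exact: ltW.
  exists x => _; move: rx; rewrite rootZ ?signr_eq0 // => rx; rewrite rx andbT.
  case/andP: xi => x1 x2; rewrite !lt_neqAle x1 x2 !andbT.
  apply/andP; split.
  - by apply: contraTneq a0 => ->; rewrite (rootP rx) mulr0 ltxx.
  - by apply: contraTneq a1 => <-; rewrite (rootP rx) mulr0 ltxx.
have [x Px] := boolp.choice ivt.
pose w i := if i is j.+1 then if (j <= n)%N then x j else root_bound else 0.
have wS i : (i <= n)%N -> w i.+1 = x i by move=> iN; rewrite /w iN.
have wl : w n.+2 = root_bound by rewrite /w ltnn.
have wv i : (i <= n)%N -> v i < w i.+1 < v i.+1.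
  by move=> iN; rewrite wS //; have /andP[] := Px _ iN.
exists w => //; split=> //.
- case=> [|i] iN.
    by have /andP[+ _] := wv 0%N isT; rewrite v0.
  have /andP[_ wi] := wv i iN; apply: (lt_le_trans wi).
  move: iN; rewrite ltnS leq_eqVlt => /orP[/eqP->|iN]; last first.
    by apply/ltW; have /andP[] := wv i.+1 iN.
  by rewrite vn wl.
- by move=> i iN; rewrite wS //; have /andP[] := Px _ iN.
- case=> [|i] iN; first by rewrite expr0 mul1r dual_poly_at0.
  move: iN; rewrite ltnS leq_eqVlt => /orP[/eqP->|iN].
    by rewrite wl; apply: dual_poly_at_bound.
  have /andP[_ /rootP rx] := Px i iN.
  (* At a root of [J n.+1] the recurrence leaves [J n.+2 = - (p * q) * J n], and the sign of [J n]
     inside the old gap is known. *)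
  have := nodes_sgn nv iN (wv i iN).
  rewrite horner_dual_poly !wS // rx mulr0 sub0r exprS.
  rewrite mulN1r mulNr mulrN opprK mulrCA => H.
  by rewrite pmulr_rgt0 // mulr_gt0.
Qed.

(** Each frame is drawn from the previous one by [nodes_step], which makes interlacing of
    consecutive levels hold by construction. *)
Fixpoint node_seq n : {v | nodes n v} :=
  if n is k.+1 then
    let: exist v nv := node_seq k in
    let: exist2 w nw _ := boolp.cid2 (nodes_step nv) in exist _ w nw
  else exist _ _ nodes0.

Definition node n : nat -> R := sval (node_seq n).

Lemma nodeP n : nodes n (node n).
Proof. exact: (svalP (node_seq n)). Qed.

Lemma node_interlace n i :
  (i <= n)%N -> node n i < node n.+1 i.+1 < node n i.+1.
Proof.
move=> iN; rewrite /node /=; case: (node_seq n) => v nv /=.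
by case: (boolp.cid2 _) => w nw /= H; apply: H.
Qed.

Lemma node_decr n k i : (i <= n.+1)%N -> node (n + k) i <= node n i.
Proof.
move=> iN; elim: k => [|k IH]; first by rewrite addn0.
rewrite addnS; apply: le_trans IH; case: i iN => [|i] iN.
  by rewrite !(nodes_first (nodeP _)).
have /node_interlace/andP[_ /ltW//] : (i <= n + k)%N.
by rewrite (leq_trans _ (leq_addr _ _)).
Qed.

(** The last index of level [n] is [n.+1], so shifting the index along with the level keeps the rank
    counted from the top. *)
Lemma node_incr n k i : (i <= n.+1)%N -> node n i <= node (n + k) (i + k).
Proof.
move=> iN; elim: k => [|k IH]; first by rewrite !addn0.
apply: le_trans IH _; rewrite !addnS.
have := iN; rewrite leq_eqVlt => /orP[/eqP->|iN'].
  by rewrite addSn (nodes_last (nodeP _)) -addSn -addSn (nodes_last (nodeP _)).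
have /node_interlace/andP[/ltW//] : (i + k <= n + k)%N by rewrite leq_add2r.
Qed.

Lemma node_ge0 n i : (i <= n.+1)%N -> 0 <= node n i.
Proof.
case: i => [|i] iN; first by rewrite (nodes_first (nodeP _)).
by rewrite -(nodes_first (nodeP n)); apply/ltW/(nodes_mono (nodeP n)).
Qed.

Lemma node_le_bound n i : (i <= n.+1)%N -> node n i <= root_bound.
Proof.
rewrite leq_eqVlt => /orP[/eqP->|iN]; rewrite -(nodes_last (nodeP n)) //.
exact/ltW/(nodes_mono (nodeP n)).
Qed.

End Interlacing.

(** * The spectrum of the gauge capacitance matrix *)

Lemma sum_ord_eq (V : nmodType) (n k : nat) (G : nat -> V) :
  \sum_(j < n) (if j == k :> nat then G j else 0) = if (k < n)%N then G k else 0.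
Proof.
case: ifP => [kn|/negbT kn].
  rewrite (bigD1 (Ordinal kn)) //= eqxx big1 ?addr0 // => j.
  by rewrite -val_eqE /= => /negPf->.
rewrite big1 // => j _; case: eqP => // E.
by move: kn; rewrite -E ltn_ord.
Qed.

(** With [p] and [q] for [gauge_p] and [gauge_q], the upper and lower entries of row [i] are
    [- ell * p / s i] and [- ell * q / s i.-1]. The signs are arranged so that both coefficients are
    positive whatever the sign of [gamma]. *)
Definition gauge_p (R : realType) (gamma ell : R) : R :=
  gamma / (1 - expR (- gamma * ell)).

Definition gauge_q (R : realType) (gamma ell : R) : R :=
  gamma / (expR (gamma * ell) - 1).

Section GaugeChain.

Variables (R : realType) (gamma ell : R).
Hypotheses (gamma_neq0 : gamma != 0) (ell_gt0 : 0 < ell).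

Local Notation p := (gauge_p gamma ell).
Local Notation q := (gauge_q gamma ell).

Lemma gauge_q_gt0 : 0 < q.
Proof.
rewrite /gauge_q; have [g0|g0|/eqP] := ltgtP gamma 0; last by rewrite (negPf gamma_neq0).
- by rewrite nmulr_rgt0 // invr_lt0 subr_lt0 expR_lt1 nmulr_rlt0.
- by rewrite divr_gt0 // subr_gt0 expR_gt1 mulr_gt0.
Qed.

Lemma gauge_p_gt0 : 0 < p.
Proof.
rewrite /gauge_p; have [g0|g0|/eqP] := ltgtP gamma 0; last by rewrite (negPf gamma_neq0).
- by rewrite nmulr_rgt0 // invr_lt0 subr_lt0 expR_gt1 mulr_gt0 // oppr_gt0.
- by rewrite divr_gt0 // subr_gt0 expR_lt1 mulNr oppr_lt0 mulr_gt0.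
Qed.

Lemma expR_neq1 : expR (gamma * ell) - 1 != 0.
Proof.
by have := gauge_q_gt0; apply: contraTneq; rewrite /gauge_q => ->; rewrite invr0 mulr0 ltxx.
Qed.

Lemma gauge_pE : p = gauge_q gamma ell * expR (gamma * ell).
Proof.
rewrite /gauge_p /gauge_q mulNr expRN.
have e0 : expR (gamma * ell) != 0 by rewrite gt_eqF // expR_gt0.
by field; rewrite expR_neq1 e0.
Qed.

Lemma gauge_capacitance_mul (s : nat -> R) (N : nat) (b : nat -> R[i])
    (i : 'I_N.+1) :
  (map_mx (real_complex R) (gauge_capacitance gamma (fun=> ell) s N.+1)
     *m (\col_(j < N.+1) b j)) i 0
  = ell%:C%C * chain_op p%:C%C q%:C%C (fun j => (s j)%:C%C) N b i.
Proof.
rewrite mxE.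
set u := gauge_upper gamma (fun=> ell) s i.
set l := gauge_lower gamma (fun=> ell) s i.
pose d := - (if (i < N)%N then u else 0) - (if (0 < i)%N then l else 0).
(* The nested conditionals become three disjoint ones. The guard [0 < i] is essential, since
   [i.-1 = i] in the first row. *)
transitivity (\sum_(j < N.+1)
   ((if j == i.+1 :> nat then u%:C%C * b j else 0)
    + (if (j == i.-1 :> nat) && (0 < i)%N then l%:C%C * b j else 0)
    + (if j == i :> nat then d%:C%C * b j else 0))).
  apply: eq_bigr => j _; rewrite !mxE -/u -/l ltnS -/d.
  rewrite (_ : (j == i.-1 :> nat) && (0 < i)%N = (i == j.+1 :> nat)); last first.
    by case: (nat_of_ord i) => [|k] /=; rewrite ?andbF // andbT eq_sym.
  rewrite -[i == j]val_eqE /= [(i : nat) == j]eq_sym.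
  case: eqP => [->|_].
    by rewrite (ltn_eqF (leqnSn i.+1)) (gtn_eqF (ltnSn i)) !addr0.
  case: eqP => [->|_].
    by rewrite (ltn_eqF (ltnSn j)) addr0 add0r.
  by case: eqP => _; rewrite ?rmorph0 ?mul0r !add0r.
rewrite !big_split /= (sum_ord_eq _ _ (fun j => u%:C%C * b j)).
rewrite (sum_ord_eq _ _ (fun j => d%:C%C * b j)) ltn_ord ltnS.
have -> : \sum_(j < N.+1) (if (j == i.-1 :> nat) && (0 < i)%N then l%:C%C * b j else 0)
     = if (0 < i)%N then l%:C%C * b i.-1 else 0.
  have [i0|i0] := ltnP 0 i; last by rewrite big1 // => j _; rewrite andbF.
  under eq_bigr do rewrite andbT.
  by rewrite (sum_ord_eq _ _ (fun j => l%:C%C * b j)) ltnS (leq_trans (leq_pred _)) // -ltnS.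
have uE : u%:C%C = - (ell%:C%C * (p%:C%C / (s i)%:C%C)).
  by rewrite -fmorphV -!rmorphM -rmorphN /u /gauge_upper /gauge_p; congr _%:C%C; ring.
have lE : l%:C%C = - (ell%:C%C * (q%:C%C / (s i.-1)%:C%C)).
  rewrite -fmorphV -!rmorphM -rmorphN /l /gauge_lower /gauge_q -opprB invrN.
  by congr _%:C%C; ring.
rewrite /chain_op {}/d; move: (u) (l) uE lE => {u l} u l uE lE.
rewrite rmorphB rmorphN /=.
by case: ifP => _; case: ifP => _; rewrite ?rmorph0 ?uE ?lE; ring.
Qed.

Lemma scaled_eigenvalue_gauge (s : nat -> R) (N : nat) (z : R[i]) :
  (forall i, s i != 0) ->
  scaled_eigenvalue (gauge_capacitance gamma (fun=> ell) s N.+1) ell z <->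
  z = 0 \/ root (map_poly (real_complex R) (dual_poly p q s N)) z.
Proof.
move=> s0.
have sC0 i : (s i)%:C%C != 0 :> R[i] by rewrite fmorph_eq0.
have pC0 : p%:C%C != 0 :> R[i] by rewrite fmorph_eq0 gt_eqF // gauge_p_gt0.
have ell0 : ell%:C%C != 0 :> R[i] by rewrite fmorph_eq0 gt_eqF.
have H := chain_eigen q%:C%C N z sC0 pC0.
have E := map_dual_poly (real_complex R) p q s N.
rewrite -[dual_poly _ _ _ _]E in H; apply: iff_trans (iff_trans H _); last first.
  split=> [/eqP|[->|/rootP->]]; rewrite ?mul0r ?mulr0 //.
  by rewrite mulf_eq0 => /orP[/eqP|]; [left|right].
split.
- move=> [a a0 Ea].
  (* Beyond index [N] this takes a default value, on which [chain_op] does not depend at the sites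
     of the chain. *)
  pose b j := a (inord j) 0.
  have aE : a = \col_(j < N.+1) b j.
    by apply/colP => j; rewrite mxE /b inord_val.
  exists b.
    move: a0; apply: contraNP => H0; apply/eqP/colP => j; rewrite [RHS]mxE.
    apply/eqP; apply: contra_notT H0 => aj.
    by exists j; [rewrite -ltnS | rewrite /b inord_val].
  move=> i iN; have := gauge_capacitance_mul s b (Ordinal (iN : (i < N.+1)%N)).
  rewrite -aE Ea mxE => /= Ei; apply: (mulfI ell0); rewrite -Ei.
  by rewrite {1}aE mxE /=; ring.
- move=> [b [i0 i0N bi0] Eb]; exists (\col_(j < N.+1) b j).
    apply: contra bi0 => /eqP/colP/(_ (Ordinal (i0N : (i0 < N.+1)%N))).
    by rewrite !mxE /= => ->.
  apply/colP => i; have iN : (i <= N)%N by rewrite -ltnS ltn_ord.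
  by rewrite gauge_capacitance_mul (Eb _ iN) !mxE; ring.
Qed.

(** The dual polynomial has degree [N], so [N] distinct real roots exhaust it, which excludes
    non-real eigenvalues as well. *)
Lemma enumerates_gauge (s : nat -> R) (N : nat) (lam : nat -> R) :
  (forall i, s i != 0) -> lam 1%N = 0 ->
  uniq (mkseq (fun i => lam i.+2) N) ->
  (forall i, (i < N)%N -> root (dual_poly p q s N) (lam i.+2)) ->
  enumerates_eigenvalues (gauge_capacitance gamma (fun=> ell) s N.+1) ell lam.
Proof.
move=> s0 lam1 ulam rlam z; apply: iff_trans (scaled_eigenvalue_gauge _ _ s0) _.
have fac := dual_poly_factor s0 ulam rlam; split.
- case=> [->|]; first by exists 1%N => //; rewrite lam1 rmorph0.
  rewrite fac linearZ /= rootZ; last first.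
    by rewrite fmorph_eq0 lead_coef_eq0 -size_poly_eq0 size_dual_poly.
  rewrite rmorph_prod /= /root horner_prod prodf_seq_eq0 => /hasP[/= j _].
  rewrite rmorphB /= map_polyX map_polyC hornerXsubC subr_eq0 => /eqP->.
  by exists j.+2 => //=; apply: ltn_ord.
- move=> [[|[|k]] //= kN ->]; first by left; rewrite lam1 rmorph0.
  by right; rewrite fmorph_root; apply: rlam.
Qed.

End GaugeChain.

(** * Surjectivity of the bands onto the nonnegative reals *)

Section Bands.

Variable R : realType.

Local Notation "x %:C" := (real_complex R x).

(** The minus sign suits the argument [g - i alpha L], whose imaginary part is [- Re alpha * L]. *)
Lemma ccosh_split (y t : R) :
  ccosh (Complex y (- t)) =
  Complex ((expR y + expR (- y)) / 2 * cos t)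
          (- ((expR y - expR (- y)) / 2 * sin t)).
Proof.
apply: (mulIf (_ : (2 : R[i]) != 0)); first by rewrite pnatr_eq0.
rewrite /ccosh mulfVK ?pnatr_eq0 // mulr_natr mulr2n /cexp.
apply/eqP; rewrite eq_complex /= !opprK !mul0r !subr0 !addr0 cosN sinN.
by apply/andP; split; apply/eqP; field.
Qed.

Lemma ccosh_real (y : R) : ccosh y%:C = ((expR y + expR (- y)) / 2)%:C.
Proof.
have -> : y%:C = Complex y (- 0) by rewrite oppr0.
by rewrite ccosh_split cos0 sin0 mulr1 mulr0 oppr0.
Qed.

Lemma cosh_surj (c : R) : 1 <= c -> exists y, (expR y + expR (- y)) / 2 = c.
Proof.
(* The witness is the inverse hyperbolic cosine [ln (c + r)]; the reciprocal of [c + r] is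
   [c - r]. *)
move=> c1; pose r := Num.sqrt (c ^+ 2 - 1).
have r2 : r ^+ 2 = c ^+ 2 - 1 by rewrite sqr_sqrtr // subr_ge0 expr_ge1 // (le_trans ler01).
have cr : 0 < c + r by rewrite ltr_wpDr ?sqrtr_ge0 // (lt_le_trans ltr01).
exists (ln (c + r)); rewrite expRN lnK ?posrE //.
have -> : (c + r)^-1 = c - r.
  apply: (mulfI (lt0r_neq0 cr)); rewrite mulfV ?(lt0r_neq0 cr) //.
  by rewrite mulrC -subr_sqr r2; ring.
by field.
Qed.

(* Along [Im = 0] and [Im = pi], cosh takes the values [1 <= c] and [c <= -1];
   along the imaginary axis it takes the rest. *)
Lemma ccosh_surj (g L c : R) : 0 < L ->
  exists2 x : R * R, - (pi / L) < x.1 <= pi / L &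
    ccosh (g%:C - imag R * Complex x.1 x.2 * L%:C) = c%:C.
Proof.
move=> L0; have Ln0 : L != 0 by rewrite gt_eqF.
(* Here [t = Re alpha * L] and [y = g + Im alpha * L]; angles in [[0, pi]] stay inside the Brillouin
   zone. *)
suff [y [t [tpi H]]] : exists y t, 0 <= t <= pi /\ ccosh (Complex y (- t)) = c%:C.
  exists (t / L, (y - g) / L) => /=.
    case/andP: tpi => t0 tpi; rewrite ler_pM2r ?invr_gt0 // tpi andbT.
    rewrite -mulNr ltr_pM2r ?invr_gt0 //; apply: (lt_le_trans _ t0).
    by rewrite oppr_lt0 pi_gt0.
  rewrite -H; congr ccosh; apply/eqP; rewrite eq_complex /=.
  by apply/andP; split; apply/eqP; field.
have pi0 := pi_ge0 R.
have [c1|c1] := lerP 1 c.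
  have [y Hy] := cosh_surj c1.
  by exists y, 0; rewrite lexx pi0 ccosh_split Hy cos0 sin0 mulr1 mulr0 oppr0.
have [cN1|cN1] := lerP c (-1).
  have [|y Hy] := @cosh_surj (- c); first by rewrite lerNr.
  exists y, pi; rewrite lexx pi0 ccosh_split Hy cospi sinpi mulr0 oppr0.
  by rewrite mulrN1 opprK.
have cI : -1 <= c <= 1 by rewrite !ltW.
exists 0, (acos c); rewrite acos_ge0 // acos_lepi // ccosh_split.
by rewrite acosK // oppr0 expR0 subrr mul0r mul0r oppr0 divff ?pnatr_eq0 // mul1r.
Qed.

Lemma cexpD (r : R) (z : R[i]) : cexp (r%:C + z) = (expR r)%:C * cexp z.
Proof.
case: z => a b; rewrite /cexp /= add0r expRD.
by apply/eqP; rewrite eq_complex /=; apply/andP; split; apply/eqP; ring.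
Qed.

(** The only property of the bands that the approximation needs: a point where a band takes a value
    [0 <= l] lies in the generalised Brillouin zone. *)
Definition onto_nneg (L : R) (band : 'I_2 -> R[i] -> R[i]) : Prop :=
  forall l : R, 0 <= l -> exists (x : R * R) (i : 'I_2),
    - (pi / L) < x.1 <= pi / L /\ band i (Complex x.1 x.2) = l%:C.

Lemma single_band_onto (gamma s ell : R) : gamma != 0 -> 0 < s -> 0 < ell ->
  onto_nneg (ell + s) (single_band gamma s ell).
Proof.
move=> g0 s0 ell0 l _; have L0 : 0 < ell + s by rewrite addr_gt0.
have e1 := expR_neq1 g0 ell0.
pose h := expR (gamma * ell / 2).
have h0 : h != 0 by rewrite gt_eqF // expR_gt0.
have hh : expR (gamma * ell) = h ^+ 2.
  by rewrite expr2 -expRD; congr expR; field.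
(* With [h] as above the band equals [gamma / (s * (h ^+ 2 - 1)) * (h ^+ 2 + 1 - 2 * h * cosh (gamma
   * ell / 2 - i alpha L))]; [c] is the value of cosh that makes it [l]. *)
pose c := (h ^+ 2 + 1 - l * s * (h ^+ 2 - 1) / gamma) / (2 * h).
have [x xpi Hc] := @ccosh_surj (gamma * ell / 2) _ c L0.
exists x, 0; split=> //; rewrite /single_band.
move: Hc; set w := imag R * _ * _; rewrite /ccosh => Hc.
have -> : (expR (gamma * ell))%:C * cexp (- w) = h%:C * cexp ((gamma * ell / 2)%:C - w).
  by rewrite cexpD mulrA -rmorphM hh.
have -> : cexp w = h%:C * cexp (- ((gamma * ell / 2)%:C - w)).
  rewrite opprB addrC -rmorphN cexpD mulrA -rmorphM /h -expRD subrr expR0.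
  by rewrite rmorph1 mul1r.
have E : h%:C * cexp ((gamma * ell / 2)%:C - w)
         + h%:C * cexp (- ((gamma * ell / 2)%:C - w)) = (2 * h * c)%:C.
  rewrite -mulrDr [RHS]rmorphM /= -Hc (rmorphM _ 2 h) rmorph_nat /=.
  by field.
rewrite -[X in _ * X]addrA -opprD E hh -(rmorph1 (real_complex R)) -rmorphD -rmorphB -rmorphM.
congr (_%:C); rewrite /c hh in e1 *; field.
by rewrite e1 h0 g0 gt_eqF.
Qed.

Lemma dimer_band_onto (gamma s1 s2 : R) : gamma != 0 -> 0 < s1 -> 0 < s2 ->
  onto_nneg (2 + s1 + s2) (dimer_band gamma s1 s2).
Proof.
move=> g0 s10 s20 l _; have L0 : 0 < 2 + s1 + s2 by rewrite !addr_gt0.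
have e1 : expR gamma - 1 != 0 by have := expR_neq1 g0 ltr01; rewrite mulr1.
pose h := Num.sqrt 2 * expR (gamma / 2).
have h0 : h != 0 by rewrite gt_eqF // mulr_gt0 ?expR_gt0 ?sqrtr_gt0.
(* [X] is the signed root that gives the band the value [l], and [c] makes the radicand equal to
   [X ^+ 2]. The principal root is then [|X|], so the sign of [X] selects the band. *)
pose X := (2 * (expR gamma - 1) * s1 * s2 * l / gamma - (expR gamma + 1) * (s1 + s2)) / h.
pose ch := (expR gamma + expR (- gamma)) / 2.
pose c := (X ^+ 2 - ch * (s1 - s2) ^+ 2 - (s1 + s2) ^+ 2) / (4 * s1 * s2).
have [x xpi Hc] := @ccosh_surj gamma _ c L0.
have s1n : s1 != 0 by rewrite gt_eqF.
have s2n : s2 != 0 by rewrite gt_eqF.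
exists x, (if 0 <= X then 1 else 0); split=> //; rewrite /dimer_band Hc ccosh_real.
rewrite -/ch -/h -!rmorphM -!rmorphD.
have -> : 4 * s1 * s2 * c + ch * (s1 - s2) ^+ 2 + (s1 + s2) ^+ 2 = X ^+ 2.
  by rewrite /c; field; rewrite s1n s2n.
rewrite sqrtc_sqrtr ?ler0c ?sqr_ge0 // [complex.Re _]/= sqrtr_sqr.
have -> : (if (if 0 <= X then 1 else 0 : 'I_2) == 0 then -1 else 1) * (h%:C * `|X|%:C)
   = (h * X)%:C.
  have [X0|X0] := leP 0 X.
    by rewrite mul1r ger0_norm // -rmorphM.
  by rewrite eqxx ltr0_norm // mulN1r -rmorphM -rmorphN mulrN opprK.
rewrite -rmorphD -rmorphM -fmorphV -rmorphM; congr (_%:C).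
rewrite /X; field.
by rewrite g0 e1 s1n s2n h0.
Qed.

Lemma normc_real (x : R) : Normc.normc x%:C = `|x|.
Proof. by rewrite /= expr0n addr0 sqrtr_sqr. Qed.

Local Open Scope classical_set_scope.

Lemma approaches_fixed_point_cvg (L : R) (band : 'I_2 -> R[i] -> R[i])
    (mu : nat -> R) (l : R) :
  onto_nneg L band -> 0 <= l -> mu n @[n --> \oo] --> l ->
  approaches_fixed_point L band mu.
Proof.
move=> onto l0 mul; have [x [i [xpi Hl]]] := onto _ l0.
exists x, i; split.
  by split=> //; exists i; rewrite Hl ler0c.
rewrite Hl.
under eq_fun do rewrite -rmorphB normc_real.
rewrite -(normr0 R) -(subrr l).
by apply: cvg_norm; apply: cvgB => //; apply: cvg_cst.
Qed.

Lemma approaches_moving_point_nneg (L : R) (band : 'I_2 -> R[i] -> R[i])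
    (mu : nat -> R) :
  onto_nneg L band -> (forall n, (0 < n)%N -> 0 <= mu n) ->
  approaches_moving_point L band mu.
Proof.
move=> onto mu0.
have H n : exists xi : (R * R) * 'I_2,
    generalised_brillouin_zone L band xi.1 /\
    ((0 < n)%N -> band xi.2 (Complex xi.1.1 xi.1.2) = (mu n)%:C).
  (* The term of index 0 is not assumed nonnegative, yet its point must lie in the zone too; it is
     sent to the value 0. *)
  have : 0 <= (if (0 < n)%N then mu n else 0) by case: ifP => // /mu0.
  move=> /[dup] l0 /onto [x [i [xpi Hl]]]; exists (x, i); split.
    by split=> //; exists i; rewrite Hl ler0c.
  by move=> n0; rewrite Hl n0.
have [f Hf] := boolp.choice H.
exists (fst \o f), (snd \o f); split; first by move=> n; case: (Hf n).
apply: cvg_near_cst; exists 1%N => // n n1 /=; have [_ ->//] := Hf n.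
by rewrite subrr Normc.normc0.
Qed.

End Bands.

(** * Equal spacings and Chebyshev polynomials *)

(** This is [(- r) ^+ n] times the Chebyshev polynomial of the second kind at [cos t], multiplied
    through by [sin t] to avoid dividing. *)
Lemma dual_poly_sin (R : realType) (p q r z t : R) (s : nat -> R) (n : nat) :
  p * q = r ^+ 2 -> (forall i, p + q - s i * z = - (2 * r * cos t)) ->
  sin t * (dual_poly p q s n).[z] = (- r) ^+ n * sin (t * n.+1%:R).
Proof.
move=> pq sz.
have sinS k : sin (t * k.+2%:R) = 2 * cos t * sin (t * k.+1%:R) - sin (t * k%:R).
  have -> : t * k.+2%:R = t * k.+1%:R + t by rewrite -natr1 mulrDr mulr1.
  have -> : t * k%:R = t * k.+1%:R - t by rewrite -natr1 mulrDr mulr1 addrK.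
  by rewrite sinD sinB; ring.
elim/ltn_ind: n => -[|[|n]] IH.
- by rewrite horner_dual_poly0 expr0 mulr1 mul1r mulr1.
- by rewrite horner_dual_poly1 sz sinS mulr1 mulr0 sin0; ring.
- rewrite horner_dual_poly sz pq sinS.
  have E1 := IH n.+1 (ltnSn _); have E0 := IH n (ltnW (ltnSn _)).
  transitivity (- (2 * r * cos t) * (sin t * (dual_poly p q s n.+1).[z])
                - r ^+ 2 * (sin t * (dual_poly p q s n).[z])); first by ring.
  by rewrite E1 E0 !exprS; ring.
Qed.

Section SingleChain.

Variables (R : realType) (gamma s ell : R).
Hypotheses (gamma_neq0 : gamma != 0) (s_gt0 : 0 < s) (ell_gt0 : 0 < ell).

Local Notation q := (gauge_q gamma ell).
Local Notation h := (expR (gamma * ell / 2)).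

Let hh : expR (gamma * ell) = h ^+ 2.
Proof. by rewrite expr2 -expRD; congr expR; field. Qed.

Let h_gt0 : 0 < h. Proof. exact: expR_gt0. Qed.

Let q_gt0 : 0 < q. Proof. exact: gauge_q_gt0. Qed.

(** As [p = q * h ^+ 2], this says that [s] times the eigenvalue is
    [p + q + 2 * sqrt (p * q) * cos t], the form required by [dual_poly_sin]. *)
Lemma single_eigenvalueE (N k : nat) : k != 1%N ->
  single_eigenvalue gamma s ell N k
  = q / s * (h ^+ 2 + 1 + 2 * h * cos (pi / N%:R * k.-1%:R)).
Proof.
move=> /negPf k1; rewrite /single_eigenvalue k1.
have e1 := expR_neq1 gamma_neq0 ell_gt0; rewrite hh in e1.
have h0 : h != 0 by rewrite gt_eqF.
have -> : gamma / s * coth (gamma * ell / 2) = q / s * (h ^+ 2 + 1).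
  rewrite /coth expRN /gauge_q hh; set y := h in e1 h0 *.
  by field; rewrite e1 h0 (gt_eqF s_gt0).
have -> : 2 * `|gamma| / s * (h / `|expR (gamma * ell) - 1|) = q / s * (2 * h).
  rewrite -(ger0_norm (ltW q_gt0)) /gauge_q normrM normfV.
  by field; rewrite (gt_eqF s_gt0) normr_eq0 hh.
by rewrite -(mulrA (q / s)) -mulrDr.
Qed.

Lemma single_eigenvalue_ge0 N k : 0 <= single_eigenvalue gamma s ell N k.
Proof.
have [->|k1] := eqVneq k 1%N; first by rewrite /single_eigenvalue eqxx.
rewrite single_eigenvalueE //; apply: mulr_ge0.
  by apply: divr_ge0; apply: ltW.
set c := cos _; have c1 : -1 <= c by apply: cos_geN1.
(* The bracket equals [(h - 1) ^+ 2 + 2 * h * (c + 1)]. *)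
have : 0 <= 2 * h * (c + 1) by rewrite !mulr_ge0 ?(ltW h_gt0) // -lerBlDr sub0r.
have := sqr_ge0 (h - 1); lra.
Qed.

Lemma single_enumerates N : (0 < N)%N ->
  enumerates_eigenvalues (gauge_capacitance gamma (fun=> ell) (fun=> s) N) ell
    (single_eigenvalue gamma s ell N).
Proof.
case: N => // n _.
(* These are the zeros of [sin (n.+1 * t)] in the open interval from 0 to [pi], where cos is
   injective and sin does not vanish. *)
pose t i : R := pi / n.+1%:R * i.+1%:R.
have lamE i : single_eigenvalue gamma s ell n.+1 i.+2
              = q / s * (h ^+ 2 + 1 + 2 * h * cos (t i)) by rewrite single_eigenvalueE.
have n0 : (n.+1%:R : R) != 0 by rewrite pnatr_eq0.
have tpi i : (i < n)%N -> 0 < t i < pi.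
  move=> iN; rewrite /t mulr_gt0 ?divr_gt0 ?pi_gt0 //=.
  by rewrite mulrAC ltr_pdivrMr // ltr_pM2l ?pi_gt0 // ltr_nat ltnS.
have s0 : s != 0 by rewrite gt_eqF.
apply: enumerates_gauge => // [|i iN].
- apply/mkseq_uniqP => i j /[!inE] iN jN; rewrite !lamE.
  move/(mulfI (_ : q / s != 0)).
  rewrite gt_eqF; last by apply: divr_gt0.
  move=> /(_ isT)/addrI/(mulfI (_ : 2 * h != 0)).
  rewrite gt_eqF; last by apply: mulr_gt0.
  move=> /(_ isT)/cos_inj.
  rewrite !in_itv /=; have /andP[/ltW-> /ltW->] := tpi _ iN.
  have /andP[/ltW-> /ltW->] := tpi _ jN => /(_ isT isT)/mulfI.
  rewrite mulf_neq0 ?invr_eq0 ?gt_eqF ?pi_gt0 // => /(_ isT)/eqP.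
  by rewrite eqr_nat eqSS => /eqP.
- have pE : gauge_p gamma ell = q * h ^+ 2 by rewrite gauge_pE // hh.
  have sint : sin (t i) != 0 by rewrite gt_eqF // sin_gt0_pi // tpi.
  rewrite /root -(mulrI_eq0 _ (mulfI sint)).
  rewrite (@dual_poly_sin _ _ _ (q * h)).
  + have -> : t i * n.+1%:R = pi *+ i.+1 by rewrite /t -mulr_natr; field.
    suff -> : sin (pi *+ i.+1) = 0 :> R by rewrite mulr0.
    elim: i.+1 => [|k IH]; first by rewrite mulr0n sin0.
    by rewrite mulrSr sinDpi IH oppr0.
  + by rewrite pE; ring.
  + by move=> _; rewrite lamE pE; field.
Qed.

Local Open Scope classical_set_scope.

(** For fixed [k] the angle tends to 0, so apart from [k = 1] the limit is always
    [q / s * (h + 1) ^+ 2]. *)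
Lemma single_eigenvalue_cvg k :
  exists2 l : R, 0 <= l & single_eigenvalue gamma s ell N k @[N --> \oo] --> l.
Proof.
have [->|k1] := eqVneq k 1%N.
  by exists 0 => //; apply: cvg_cst.
have inv0 : (N%:R^-1 : R) @[N --> \oo] --> (0 : R).
  by rewrite -(cvg_shiftn 1); under eq_fun do rewrite addn1; apply: cvg_harmonic.
have H : single_eigenvalue gamma s ell N k @[N --> \oo]
         --> q / s * (h ^+ 2 + 1 + 2 * h * cos (pi * 0 * k.-1%:R)).
  under eq_fun do rewrite single_eigenvalueE //.
  apply: cvgM; first exact: cvg_cst.
  apply: cvgD; first exact: cvg_cst.
  apply: cvgM; first exact: cvg_cst.
  apply: continuous_cvg; first exact: continuous_cos.
  apply: cvgM; last exact: cvg_cst.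
  by apply: cvgM => //; apply: cvg_cst.
exists (q / s * (h ^+ 2 + 1 + 2 * h * cos (pi * 0 * k.-1%:R))) => //.
rewrite -(cvg_lim _ H) //; apply: limr_ge; first by apply/cvg_ex; eexists; exact: H.
by apply: nearW => N; apply: single_eigenvalue_ge0.
Qed.

End SingleChain.

(** * Chains of dimers and their ordered eigenvalues *)

(** Both lists have length [N] and the same set of values. As [u] has no repetition, neither does
    [w], and sorted permutations of each other coincide. *)
Lemma increasing_enum_unique (R : realType) (N : nat) (u w : nat -> R) :
  (forall i, (i.+1 < N)%N -> u i < u i.+1) ->
  (forall i, (i.+1 < N)%N -> w i <= w i.+1) ->
  (forall i, (i < N)%N -> exists2 j, (j < N)%N & u i = w j) ->
  (forall j, (j < N)%N -> exists2 i, (i < N)%N & w j = u i) ->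
  forall i, (i < N)%N -> w i = u i.
Proof.
move=> u_lt w_le uw wu.
have su : sorted <%R (mkseq u N).
  apply/(sortedP 0) => i; rewrite size_mkseq => iN.
  by rewrite !nth_mkseq ?u_lt // ltnW.
have sw : sorted <=%R (mkseq w N).
  apply/(sortedP 0) => i; rewrite size_mkseq => iN.
  by rewrite !nth_mkseq ?w_le // ltnW.
have uu : uniq (mkseq u N) by apply: sorted_uniq su; [exact: lt_trans|exact: ltxx].
have memP (v : nat -> R) x :
    reflect (exists2 i, (i < N)%N & x = v i) (x \in mkseq v N).
  apply: (iffP mapP) => -[i iN ->]; exists i => //;
  by move: iN; rewrite mem_iota.
have mem_uw : mkseq u N =i mkseq w N.
  move=> x; apply/memP/memP => -[i iN ->]; [exact: uw|exact: wu].
have uniqw : uniq (mkseq w N).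
  apply: (leq_size_uniq uu); last by rewrite !size_mkseq.
  by move=> x; rewrite mem_uw.
have E : mkseq u N = mkseq w N.
  apply: (sorted_eq le_trans le_anti) => //; last exact: uniq_perm.
  by apply: sub_sorted su => x y; apply: ltW.
by move=> i iN; rewrite -(nth_mkseq 0 w iN) -E nth_mkseq.
Qed.

Section DimerChain.

Variables (R : realType) (gamma s1 s2 : R).
Hypotheses (gamma_neq0 : gamma != 0) (s1_gt0 : 0 < s1) (s2_gt0 : 0 < s2).

Local Notation p := (gauge_p gamma 1).
Local Notation q := (gauge_q gamma 1).
Local Notation s := (dimer_spacing s1 s2).

Let p_gt0 : 0 < p. Proof. exact: gauge_p_gt0. Qed.
Let q_gt0 : 0 < q. Proof. exact: gauge_q_gt0. Qed.

Let m_gt0 : 0 < Num.min s1 s2.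
Proof. by rewrite lt_min s1_gt0. Qed.

Let s_ge i : Num.min s1 s2 <= s i.
Proof. by rewrite /dimer_spacing; case: odd; rewrite ge_min lexx ?orbT. Qed.

Definition dimer_node (n : nat) : nat -> R := node p_gt0 q_gt0 m_gt0 s_ge n.

Let nodes_dimer n : nodes p q (Num.min s1 s2) s n (dimer_node n).
Proof. exact: nodeP. Qed.

(** Node 0 is the eigenvalue 0 and nodes [1, ..., n] are the roots; the upper frame point, of index
    [n.+1], falls outside the range. *)
Lemma dimer_node_enumerates (n : nat) :
  enumerates_eigenvalues (gauge_capacitance gamma (fun=> 1) s n.+1) 1
    (fun k => dimer_node n k.-1).
Proof.
apply: enumerates_gauge => //.
- by move=> i; rewrite gt_eqF // (lt_le_trans m_gt0).
- exact: nodes_first (nodes_dimer n).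
- exact: nodes_uniq (nodes_dimer n).
- exact: nodes_root (nodes_dimer n).
Qed.

Lemma dimer_node_le n i j : (i <= j)%N -> (j <= n.+1)%N ->
  dimer_node n i <= dimer_node n j.
Proof.
rewrite leq_eqVlt => /orP[/eqP->//|ij] jn.
exact/ltW/(nodes_mono (nodes_dimer n)).
Qed.

Section Enumeration.

Variables (n : nat) (lam : nat -> R).
Hypothesis lam_enum :
  enumerates_eigenvalues (gauge_capacitance gamma (fun=> 1) s n.+1) 1 lam.

Lemma enum_node k : (0 < k <= n.+1)%N ->
  exists2 i, (i < n.+1)%N & lam k = dimer_node n i.
Proof.
move=> kN; have /(lam_enum _).2/(dimer_node_enumerates _ _).1 : 
    exists2 k', (1 <= k' <= n.+1)%N & (lam k)%:C%C = (lam k')%:C%C by exists k.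
by case=> -[//|j] jN [->]; exists j.
Qed.

Lemma node_enum i : (i < n.+1)%N ->
  exists2 k, (0 < k <= n.+1)%N & dimer_node n i = lam k.
Proof.
move=> iN; have /(dimer_node_enumerates _ _).2/(lam_enum _).1 : 
    exists2 k', (1 <= k' <= n.+1)%N & (dimer_node n i)%:C%C = (dimer_node n k'.-1)%:C%C
    by exists i.+1.
by case=> k kN [->]; exists k.
Qed.

Lemma enum_ge0 k : (0 < k <= n.+1)%N -> 0 <= lam k.
Proof. by case/enum_node => i iN ->; apply: node_ge0; apply: ltnW. Qed.

Lemma enum_nondecreasing :
  (forall j k, (0 < j)%N -> (j <= k)%N -> (k <= n.+1)%N -> lam j <= lam k) ->
  forall k, (0 < k <= n.+1)%N -> lam k = dimer_node n k.-1.
Proof.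
move=> mono [//|k] kN.
apply: (@increasing_enum_unique _ n.+1 (dimer_node n) (lam \o succn)) => //=.
- by move=> i iN; apply: nodes_lt (nodes_dimer n) _ _; apply: ltnW.
- by move=> i iN; apply: mono.
- by move=> i /node_enum[[//|j] jN ->]; exists j.
- by move=> j jN; apply: enum_node.
Qed.

Lemma enum_nonincreasing :
  (forall j k, (0 < j)%N -> (j <= k)%N -> (k <= n.+1)%N -> lam k <= lam j) ->
  forall k, (0 < k <= n.+1)%N -> lam k = dimer_node n (n.+1 - k).
Proof.
move=> mono k /andP[k0 kN].
rewrite -{1}(subKn kN).
apply: (@increasing_enum_unique _ n.+1 (dimer_node n) (fun i => lam (n.+1 - i)%N)
          _ _ _ _ (n.+1 - k)) => [i iN|i iN|i iN|j jN|].
- by apply: nodes_lt (nodes_dimer n) _ _; apply: ltnW.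
- by apply: mono; lia.
- have [j /andP[j0 jN] ->] := node_enum iN; exists (n.+1 - j)%N; first lia.
  by rewrite subKn.
- by apply: enum_node; lia.
- lia.
Qed.

End Enumeration.

Local Open Scope classical_set_scope.

Lemma dimer_low_cvg (k : nat) : exists2 l : R, 0 <= l &
  dimer_node (2 * M).-1 k @[M --> \oo] --> l.
Proof.
(* [M] dimers have [(2 * M).-1] gaps. The shift by [k.+1] keeps index [k] in range from the start,
   and [u] then decreases. *)
pose u M := dimer_node (2 * (M + k.+1)).-1 k.
have u_ge0 M : 0 <= u M by apply: node_ge0; lia.
have u_cvg : cvgn u.
  apply: nonincreasing_is_cvgn; last by exists 0 => _ [M _ <-].
  move=> a b ab; rewrite /u.
  have -> : (2 * (b + k.+1)).-1 = ((2 * (a + k.+1)).-1 + 2 * (b - a))%N by lia.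
  by apply: node_decr; lia.
exists (limn u); last by rewrite -(cvg_shiftn k.+1).
by apply: limr_ge => //; apply: nearW.
Qed.

(** Index [2 * M] is the upper frame point, so [2 * M - k] is the [k]-th node below it; it increases
    with [M] and stays under [root_bound]. *)
Lemma dimer_high_cvg (k : nat) : exists2 l : R, 0 <= l &
  dimer_node (2 * M).-1 (2 * M - k) @[M --> \oo] --> l.
Proof.
pose u M := dimer_node (2 * (M + k.+1)).-1 (2 * (M + k.+1) - k).
have u_ge0 M : 0 <= u M by apply: node_ge0; lia.
have u_cvg : cvgn u.
  apply: nondecreasing_is_cvgn.
    move=> a b ab; rewrite /u.
    have -> : (2 * (b + k.+1)).-1 = ((2 * (a + k.+1)).-1 + 2 * (b - a))%N by lia.
    have -> : (2 * (b + k.+1) - k)%N = ((2 * (a + k.+1) - k) + 2 * (b - a))%N by lia.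
    by apply: node_incr; lia.
  by exists (root_bound p q (Num.min s1 s2)) => _ [M _ <-]; apply: node_le_bound; lia.
exists (limn u); last by rewrite -(cvg_shiftn k.+1).
by apply: limr_ge => //; apply: nearW.
Qed.

End DimerChain.

Theorem theorem4p8 (R : realType) (gamma : R) (gamma_neq0 : gamma != 0) :
  (forall s ell : R, 0 < s -> 0 < ell ->
    (forall N : nat, (0 < N)%N ->
      enumerates_eigenvalues
        (gauge_capacitance gamma (fun=> ell) (fun=> s) N) ell
        (single_eigenvalue gamma s ell N))
    /\ (forall k : nat, (1 <= k)%N ->
      approaches_fixed_point (ell + s) (single_band gamma s ell)
        (fun N => single_eigenvalue gamma s ell N k))
    /\ (forall k : nat -> nat,
      (forall N : nat, (0 < N)%N -> (1 <= k N <= N)%N) ->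
      approaches_moving_point (ell + s) (single_band gamma s ell)
        (fun N => single_eigenvalue gamma s ell N (k N))))
  /\
  (forall s1 s2 : R, 0 < s1 -> 0 < s2 ->
    (forall M : nat, (0 < M)%N -> exists lam : nat -> R,
      enumerates_eigenvalues (dimer_capacitance gamma s1 s2 M) 1 lam /\
      (forall j k : nat, (1 <= j)%N -> (j <= k)%N -> (k <= 2 * M)%N ->
        lam j <= lam k))
    /\ (forall lam : nat -> nat -> R,
      (forall M : nat, (0 < M)%N ->
        enumerates_eigenvalues (dimer_capacitance gamma s1 s2 M) 1 (lam M)) ->
      ((forall M j k : nat, (1 <= j)%N -> (j <= k)%N -> (k <= 2 * M)%N ->
          lam M j <= lam M k) \/
       (forall M j k : nat, (1 <= j)%N -> (j <= k)%N -> (k <= 2 * M)%N ->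
          lam M k <= lam M j) ->
        forall k : nat, (1 <= k)%N ->
          approaches_fixed_point (2 + s1 + s2) (dimer_band gamma s1 s2)
            (fun M => lam M k))
      /\ (forall k : nat -> nat,
        (forall M : nat, (0 < M)%N -> (1 <= k M <= 2 * M)%N) ->
        approaches_moving_point (2 + s1 + s2) (dimer_band gamma s1 s2)
          (fun M => lam M (k M))))).
Proof.
split=> [s ell s0 ell0|s1 s2 s10 s20].
  have onto := single_band_onto gamma_neq0 s0 ell0.
  split; first exact: single_enumerates.
  split=> [k _|k _].
    have [l l0 Hl] := single_eigenvalue_cvg gamma_neq0 s0 ell0 k.
    exact: approaches_fixed_point_cvg onto l0 Hl.
  by apply: approaches_moving_point_nneg => // N _; apply: single_eigenvalue_ge0.
have onto := dimer_band_onto gamma_neq0 s10 s20.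
pose v := dimer_node gamma_neq0 s10 s20.
have dblS M : (0 < M)%N -> (2 * M)%N = (2 * M).-1.+1 by move=> M0; lia.
split=> [M /dblS ME|lam lamE].
  exists (fun k => v (2 * M).-1 k.-1); split.
    by rewrite /dimer_capacitance ME; apply: dimer_node_enumerates.
  by move=> j k j0 jk kM; apply: dimer_node_le; lia.
have lam_enum M : (0 < M)%N -> enumerates_eigenvalues
    (gauge_capacitance gamma (fun=> 1) (dimer_spacing s1 s2) (2 * M).-1.+1) 1 (lam M).
  by move=> M0; rewrite -dblS //; apply: lamE.
split=> [mono k k0|k kM]; last first.
  apply: approaches_moving_point_nneg => // M M0.
  by apply: (enum_ge0 gamma_neq0 s10 s20 (lam_enum _ M0)); rewrite -dblS // kM.
suff [l l0 Hl] : exists2 l : R, 0 <= l & (lam M k @[M --> \oo] --> l)%classic.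
  exact: approaches_fixed_point_cvg onto l0 Hl.
case: mono => mono.
- have [l l0 Hl] := dimer_low_cvg gamma_neq0 s10 s20 k.-1.
  (* From [M = k] on, the rank [k] lies between 1 and [2 * M], so the given enumeration agrees with
     the nodes. *)
  exists l => //; apply: cvg_trans Hl; apply: near_eq_cvg; exists k => // M /= kM.
  have M0 : (0 < M)%N by lia.
  apply/esym/(enum_nondecreasing gamma_neq0 s10 s20 (lam_enum _ M0)); last lia.
  by rewrite -dblS //; apply: mono.
- have [l l0 Hl] := dimer_high_cvg gamma_neq0 s10 s20 k.
  exists l => //; apply: cvg_trans Hl; apply: near_eq_cvg; exists k => // M /= kM.
  have M0 : (0 < M)%N by lia.
  rewrite {2}dblS //.
  apply/esym/(enum_nonincreasing gamma_neq0 s10 s20 (lam_enum _ M0)); last lia.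
  by rewrite -dblS //; apply: mono.
Qed.
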